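(* Let $G=P_n$ be the path graph on $n\ge 3$ vertices. Then $$\operatorname{depth} S/I_c(G)^k\ =\ \begin{cases} n-k-1 & \text{for } 1\le k\le n-3,\\ 1 & \text{for } k\ge n-2.\end{cases}$$ In particular, $\operatorname{dstab}(I_c(P_n))=n-2$.
   Context: Let $K$ be a field and $S=K[x_1,\dots,x_n]$. The path graph $P_n$ has vertex set $[n]=\{1,\dots,n\}$ and edges $\{i,i+1\}$ for $1\le i\le n-1$. For a finite simple graph $G$ on vertex set $[n]$ with edge set $E(G)$, the complementary edge ideal is $I_c(G)=((x_1\cdots x_n)/(x_ix_j):\{i,j\}\in E(G))\subset S$. The index of depth stability $\operatorname{dstab} I$ of an ideal $I\subset S$ is the least integer $k_0>0$ such that $\operatorname{depth} S/I^k=\operatorname{depth} S/I^{k_0}$ for all $k\ge k_0$. *)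

(* Defs.v *)
From HB Require Import structures.
From mathcomp Require Import all_boot all_order all_algebra.
From mathcomp Require Import mpoly.

Set Implicit Arguments.
Unset Strict Implicit.
Unset Printing Implicit Defensive.

Import GRing.Theory.
Local Open Scope ring_scope.

(* Ideals are arbitrary [Prop]-valued predicates on the ring, since membership
   is not assumed decidable. *)

Section Ideals.
Variable R : comNzRingType.
Implicit Types (G I J : R -> Prop) (s : seq R).

Definition ideal_gen G (f : R) : Prop :=
  exists s : seq (R * R),
    (forall p, p \in s -> G p.2) /\ f = \sum_(p <- s) p.1 * p.2.

(* For k = 0 the only product is the empty one, so I^0 is the whole ring. *)
Definition ideal_pow I (k : nat) : R -> Prop :=
  ideal_gen (fun f => exists s : seq R,
    [/\ size s = k, forall a, a \in s -> I a & f = \prod_(a <- s) a]).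

(* J + (s) *)
Definition ideal_adjoin J s : R -> Prop :=
  ideal_gen (fun f => J f \/ f \in s).

(* [s] = f_1, ..., f_r is a regular sequence on M = R/J.  The quotient
   M/(f_1, ..., f_i)M is R/(J + (f_1, ..., f_i)), so that "f_(i+1) is a
   nonzerodivisor on it" and "M/(f_1, ..., f_r)M is nonzero" are written as
   conditions on the ideals J + (f_1, ..., f_i). *)
Definition regular_on_quot J s : Prop :=
  (forall i, (i < size s)%N -> forall g : R,
     ideal_adjoin J (take i s) (s`_i * g) -> ideal_adjoin J (take i s) g)
  /\ ~ ideal_adjoin J s 1.

End Ideals.

Section Depth.
Variables (K : fieldType) (n : nat).
Implicit Types (I J : {mpoly K[n]} -> Prop).

Definition irrelevant_ideal : {mpoly K[n]} -> Prop :=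
  ideal_gen (fun f => exists i : 'I_n, f = 'X_i).

(* depth S/J = d, where depth S/J is the maximal length of an S/J-regular
   sequence contained in (x_1, ..., x_n). *)
Definition depth_quot_is J (d : nat) : Prop :=
  (exists s : seq {mpoly K[n]},
     [/\ size s = d, forall f, f \in s -> irrelevant_ideal f
       & regular_on_quot J s])
  /\ (forall s : seq {mpoly K[n]},
        (forall f, f \in s -> irrelevant_ideal f) ->
        regular_on_quot J s -> (size s <= d)%N).

Definition depth_stable_from I (k0 : nat) : Prop :=
  exists d : nat, forall k, (k0 <= k)%N -> depth_quot_is (ideal_pow I k) d.

(* dstab I = k0 *)
Definition dstab_is I (k0 : nat) : Prop :=
  [/\ (0 < k0)%N, depth_stable_from I k0
    & forall k, (0 < k)%N -> depth_stable_from I k -> (k0 <= k)%N].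

End Depth.

Record simple_graph (n : nat) := SimpleGraph {
  adj :> rel 'I_n;
  adj_sym : ssrbool.symmetric adj;
  adj_irr : irreflexive adj
}.

Section PathGraph.
Variable n : nat.

Definition path_adj : rel 'I_n :=
  fun i j => (j == i.+1 :> nat) || (i == j.+1 :> nat).

Lemma path_adj_sym : ssrbool.symmetric path_adj.
Proof. by move=> i j; rewrite /path_adj orbC. Qed.

Lemma path_adj_irr : irreflexive path_adj.
Proof. by move=> i; rewrite /path_adj orbb ltn_eqF. Qed.

Definition path_graph : simple_graph n :=
  SimpleGraph path_adj_sym path_adj_irr.

End PathGraph.

(* Since i and j are distinct for an edge {i, j}, the monomial
   (x_1 ... x_n)/(x_i x_j) is the product of the other variables. *)
Definition compl_edge_ideal (K : fieldType) (n : nat) (G : simple_graph n) :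
    {mpoly K[n]} -> Prop :=
  ideal_gen (fun f => exists i j : 'I_n,
    G i j /\ f = \prod_(l < n | (l != i) && (l != j)) 'X_l).

Arguments compl_edge_ideal K {n} G f.

(* Main.v *)
Require Import Defs.
From HB Require Import structures.
From mathcomp Require Import all_boot all_order all_algebra.
From mathcomp Require Import mpoly.
From mathcomp Require Import zify ring.

Set Implicit Arguments.
Unset Strict Implicit.
Unset Printing Implicit Defensive.

Import GRing.Theory.
Local Open Scope ring_scope.

(** With variables numbered from 0, let [u_a] be the product of the variables
    other than [x_a] and [x_(a+1)], so that [I = (u_0, ..., u_(n-2))], and let
    [p = min(k, n - 2)].  Both cases of the formula say that the depth of
    [S/I^k] is [n - 1 - p].

    Upper bound.  Any two consecutive generators satisfy the linear relation
    [x_a u_a = x_(a+2) u_(a+1)], that is, [z_a = u_a e_a - u_(a+1) e_(a+2)] is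
    a cycle of the Koszul complex of the variables.  Since the differential is
    an antiderivation, [u_0^(k-p) z_0 /\ ... /\ z_(p-1)] is a cycle of degree
    [p], and its coefficients are in [I^k], of the least degree [k (n - 2)]
    that occurs there.  In the Koszul complex of [S] it is the boundary of an
    explicit chain [z] of degree [p + 1], so that [z] is a cycle modulo [I^k].
    If the quotient had a regular sequence of more than [n - 1 - p] elements,
    its Koszul homology would vanish in degree [p + 1]
    ([koszul_vanishing]), hence [z] would be homologous to a chain with
    coefficients in [I^k], whose boundary has coefficients of degree greater
    than [k (n - 2)].  But the coefficient of [e_0 /\ ... /\ e_(p-1)] in the
    boundary of [z] is, up to sign, [u_0^(k-p) u_0 ... u_(p-1)], a nonzero
    polynomial of degree [k (n - 2)] ([regular_path_size]).

    Lower bound.  The elementary symmetric polynomials of degrees [d, ..., 1]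
    form a regular sequence modulo any [n - d] or fewer variables
    ([wreg_esyms]).  A sequence that is regular, except perhaps that the last
    quotient is zero, on [S/(J : g)] and on [S/(J + (g))] is regular in the
    same sense on [S/J] ([wreg_split]).  So it suffices to break up [S/I^k], by
    repeated use of this for monomials [g], into quotients modulo at most
    [n - d] variables each, where [d = n - 1 - p].  This is done by induction
    on the number of vertices, splitting off the last variable [x]: as [I] is
    [x I' + (u)], where [I'] is the ideal of the shorter path and [u] is a
    multiple of one of its generators, [I^k] is the sum of the ideals
    [x^j u^(k-j) I'^j], which only involves the lower powers of [I']
    ([wreg_path]). *)

(** * Ideals and weakly regular sequences *)

Section WeaklyRegular.
Variable R : comNzRingType.
Implicit Types (J : R -> Prop) (f g h : R) (s : seq R).

Record is_ideal J : Prop := IsIdeal {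
  ideal0 : J 0;
  idealD : forall f g, J f -> J g -> J (f + g);
  idealM : forall a f, J f -> J (a * f) }.

Definition eq_ideal J J' := forall f, J f <-> J' f.

Lemma idealN J f : is_ideal J -> J f -> J (- f).
Proof. by move=> iJ Jf; rewrite -mulN1r; apply: idealM. Qed.

Lemma idealB J f g : is_ideal J -> J f -> J g -> J (f - g).
Proof. by move=> iJ Jf Jg; apply: idealD => //; apply: idealN. Qed.

Lemma ideal_sum J (I : Type) (r : seq I) (P : pred I) (F : I -> R) :
  is_ideal J -> (forall i, P i -> J (F i)) -> J (\sum_(i <- r | P i) F i).
Proof.
move=> iJ JF; apply: (big_ind J) => //; first exact: ideal0.
exact: idealD.
Qed.

Lemma ideal_gen_ideal (G : R -> Prop) : is_ideal (ideal_gen G).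
Proof.
split=> [|f g [s [Gs ->]] [t [Gt ->]]|a f [s [Gs ->]]].
- by exists [::]; split=> [p|]; rewrite ?big_nil ?in_nil.
- exists (s ++ t); rewrite big_cat; split=> // p.
  by rewrite mem_cat => /orP[/Gs|/Gt].
exists [seq (a * p.1, p.2) | p <- s]; split.
  by move=> q /mapP[p ps ->] /=; apply: Gs.
by rewrite big_map mulr_sumr; apply: eq_bigr => p _; rewrite mulrA.
Qed.

Lemma mem_ideal_gen (G : R -> Prop) f : G f -> ideal_gen G f.
Proof.
move=> Gf; exists [:: (1, f)]; rewrite big_seq1 mul1r; split=> // p.
by rewrite inE => /eqP ->.
Qed.

Lemma ideal_gen_min (G J : R -> Prop) :
  is_ideal J -> (forall f, G f -> J f) -> forall f, ideal_gen G f -> J f.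
Proof.
move=> iJ GJ f [s [Gs ->]]; rewrite big_seq; apply: ideal_sum => // p ps.
by apply: idealM => //; apply/GJ/Gs.
Qed.

Lemma ideal_powM (I : R -> Prop) j k f g :
  ideal_pow I j f -> ideal_pow I k g -> ideal_pow I (j + k) (f * g).
Proof.
move=> Ijf [t [It ->]]; rewrite mulr_sumr big_seq.
apply: ideal_sum => [|q qt]; first exact: ideal_gen_ideal.
rewrite mulrCA; apply: idealM; first exact: ideal_gen_ideal.
have [u [su Iu ->]] := It _ qt; case: Ijf => s [Is ->].
rewrite mulr_suml big_seq; apply: ideal_sum => [|p ps].
  exact: ideal_gen_ideal.
rewrite -mulrA; apply: idealM; first exact: ideal_gen_ideal.
have [v [sv Iv ->]] := Is _ ps; apply: mem_ideal_gen.
exists (v ++ u); rewrite size_cat big_cat sv su; split=> // a.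
by rewrite mem_cat => /orP[/Iv|/Iu].
Qed.

Lemma ideal_pow0 (I : R -> Prop) f : ideal_pow I 0 f.
Proof.
rewrite -[f]mulr1; apply: idealM; first exact: ideal_gen_ideal.
by apply: mem_ideal_gen; exists [::]; rewrite big_nil; split.
Qed.

Lemma ideal_powX (I : R -> Prop) k f : I f -> ideal_pow I k (f ^+ k).
Proof.
move=> If; apply: mem_ideal_gen; exists (nseq k f); rewrite size_nseq.
split=> // [a|]; first by move=> /nseqP[->].
by rewrite big_nseq -Monoid.iteropE.
Qed.

Lemma ideal_pow_min (I : R -> Prop) (J : nat -> R -> Prop) :
  (forall k, is_ideal (J k)) -> J 0 1 -> (forall f, I f -> J 1 f) ->
  (forall j k f g, J j f -> J k g -> J (j + k) (f * g)) ->
  forall k f, ideal_pow I k f -> J k f.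
Proof.
move=> iJ J0 J1 JM k f; apply: ideal_gen_min => // {}f [s [<- Is ->]].
elim: s Is => [|a s IH] Is; first by rewrite big_nil.
rewrite big_cons /= -add1n; apply: (JM 1%N).
  by apply/J1/Is/mem_head.
by apply: IH => b bs; apply: Is; rewrite inE bs orbT.
Qed.

(** [J + (f)] and [J : f]: multiplication by [f] embeds [R/(J : f)] into [R/J],
    with cokernel [R/(J + (f))]. *)
Definition addp J f : R -> Prop := fun g => exists a, J (g - a * f).
Definition colon J f : R -> Prop := fun g => J (f * g).

Lemma addp_ideal J f : is_ideal J -> is_ideal (addp J f).
Proof.
move=> iJ; split=> [|g h [a Ja] [b Jb]|c g [a Ja]].
- by exists 0; rewrite mul0r subr0; apply: ideal0.
- by exists (a + b); rewrite mulrDl opprD addrACA; apply: idealD.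
by exists (c * a); rewrite -mulrA -mulrBr; apply: idealM.
Qed.

Lemma sub_addp J f g : J g -> addp J f g.
Proof. by move=> Jg; exists 0; rewrite mul0r subr0. Qed.

Lemma mem_addp J f a : is_ideal J -> addp J f (a * f).
Proof. by move=> iJ; exists a; rewrite subrr; apply: ideal0. Qed.

Lemma addp_self J f : is_ideal J -> addp J f f.
Proof. by move=> iJ; exists 1; rewrite mul1r subrr; apply: ideal0. Qed.

Lemma addp_min J J' f g : is_ideal J' -> (forall h, J h -> J' h) -> J' f ->
  addp J f g -> J' g.
Proof.
move=> iJ' sJ J'f [a Ja]; rewrite -[g](subrK (a * f)).
by apply: idealD; [|apply: sJ|apply: idealM].
Qed.

Lemma addpC J f g h : addp (addp J f) g h -> addp (addp J g) f h.
Proof. by case=> a [b Jb]; exists b, a; rewrite addrAC. Qed.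

Lemma eq_addp J J' f : eq_ideal J J' -> eq_ideal (addp J f) (addp J' f).
Proof. by move=> eJ g; split=> -[a /eJ Ja]; exists a. Qed.

(** Regularity of a sequence without the requirement that the last quotient
    be nonzero; dropping it makes the notion closed under extensions. *)
Fixpoint wreg J s : Prop :=
  if s is f :: s' then (forall g, J (f * g) -> J g) /\ wreg (addp J f) s'
  else True.

Lemma eq_wreg J J' s : eq_ideal J J' -> wreg J s -> wreg J' s.
Proof.
elim: s J J' => //= f s IH J J' eJ [reg wr]; split.
  by move=> g /eJ/reg/eJ.
exact: IH (eq_addp f eJ) wr.
Qed.

Lemma wreg1 J s : is_ideal J -> J 1 -> wreg J s.
Proof.
have all J' g : is_ideal J' -> J' 1 -> J' g.
  by move=> iJ J1; rewrite -[g]mulr1; apply: idealM.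
elim: s J => //= f s IH J iJ J1; split; first by move=> *; apply: all.
by apply: IH; [apply: addp_ideal | apply: sub_addp].
Qed.

(** The sequence [0 -> R/(J : g) -> R/J -> R/(J + (g)) -> 0] is exact, and
    stays so modulo an element that is regular on its right end. *)
Lemma wreg_split J g s :
  is_ideal J -> wreg (colon J g) s -> wreg (addp J g) s -> wreg J s.
Proof.
elim: s J => //= f s IH J iJ [reg1 wr1] [reg2 wr2]; split.
  move=> h Jfh; have [a Ja] := reg2 h (sub_addp g Jfh).
  have Jga : colon J g a.
    apply: reg1; rewrite /colon.
    have -> : g * (f * a) = f * h - f * (h - a * g) by ring.
    by apply: idealB => //; apply: idealM.
  by rewrite -[h](subrK (a * g)); apply: idealD => //; rewrite mulrC.
apply: IH; first exact: addp_ideal.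
  apply: eq_wreg wr1 => h; split=> [[a Ja]|[a Ja]].
    by exists (g * a); rewrite -mulrA -mulrBr.
  have [b Jb] : addp J g a.
    by apply: reg2; exists h; rewrite mulrC -opprB [h * g]mulrC; apply: idealN.
  exists b; rewrite /colon.
  have -> : g * (h - b * f) = (g * h - a * f) + f * (a - b * g) by ring.
  by apply: idealD => //; apply: idealM.
by apply: eq_wreg wr2 => h; split; apply: addpC.
Qed.

Lemma ideal_adjoin_nil J : is_ideal J -> eq_ideal (ideal_adjoin J [::]) J.
Proof.
move=> iJ f; split; last by move=> Jf; apply: mem_ideal_gen; left.
by apply: ideal_gen_min => // g [].
Qed.

Lemma ideal_adjoin_cons J f s : is_ideal J ->
  eq_ideal (ideal_adjoin J (f :: s)) (ideal_adjoin (addp J f) s).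
Proof.
move=> iJ g; split; apply: ideal_gen_min; try exact: ideal_gen_ideal.
  move=> h [Jh|]; first by apply: mem_ideal_gen; left; apply: sub_addp.
  rewrite inE => /predU1P[->|hs]; apply: mem_ideal_gen; last by right.
  by left; apply: addp_self.
move=> h [|hs]; last by apply: mem_ideal_gen; right; rewrite inE hs orbT.
apply: addp_min; first exact: ideal_gen_ideal.
  by move=> *; apply: mem_ideal_gen; left.
by apply: mem_ideal_gen; right; apply: mem_head.
Qed.

Lemma wregP J s : is_ideal J ->
  wreg J s <-> (forall i, (i < size s)%N -> forall g,
     ideal_adjoin J (take i s) (s`_i * g) -> ideal_adjoin J (take i s) g).
Proof.
elim: s J => [|f s IH] J iJ; first by split.
have iA := addp_ideal f iJ; split=> [[reg wr] [_ g|i ilt g]|reg].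
- by rewrite take0 => /(ideal_adjoin_nil iJ)/reg Jg; apply/ideal_adjoin_nil.
- move=> /(ideal_adjoin_cons f _ iJ) Jg; apply/ideal_adjoin_cons => //.
  by move: Jg; apply: (IH _ iA).1.
split=> [g Jg|].
  apply/(ideal_adjoin_nil iJ); apply: (reg 0%N) => //.
  by apply/ideal_adjoin_nil.
apply/(IH _ iA) => i ilt g Jg; apply/(ideal_adjoin_cons f _ iJ).
by apply: (reg i.+1) => //; apply/ideal_adjoin_cons.
Qed.

End WeaklyRegular.

(** * The Koszul complex and an upper bound for the depth *)

Section Koszul.
Variable R : comNzRingType.
Implicit Types (J : R -> Prop) (s : seq R) (v w x : nat -> R).

(** The exterior algebra of [R^m]: the pair [(a, b)] stands for
    [a + e_m /\ b], where [a] and [b] only involve [e_0, ..., e_(m-1)].  With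
    this encoding no signs have to be attached to subsets. *)
Fixpoint ext (m : nat) : lmodType R :=
  if m is m'.+1 then ((ext m' * ext m')%type : lmodType R) else R^o.

Fixpoint ext1 m : ext m :=
  match m return ext m with 0 => (1 : R^o) | m'.+1 => (ext1 m', 0) end.

(** Contraction by [x]: the Koszul differential of [x_0, ..., x_(m-1)]. *)
Fixpoint bd x m : ext m -> ext m :=
  match m return ext m -> ext m with
  | 0 => fun=> 0
  | m'.+1 => fun z => (bd x z.1 + x m' *: z.2, - bd x z.2)
  end.

(** Left multiplication by the vector [v_0 e_0 + ... + v_(m-1) e_(m-1)]. *)
Fixpoint wd v m : ext m -> ext m :=
  match m return ext m -> ext m with
  | 0 => fun=> 0
  | m'.+1 => fun z => (wd v z.1, v m' *: z.1 - wd v z.2)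
  end.

Lemma bd_linear x m : linear (@bd x m).
Proof.
elim: m => [|m IH] a z w /=; first by rewrite scaler0 addr0.
rewrite !IH; congr (_, _) => /=.
  by rewrite scalerDr !scalerA [x m * a]mulrC scalerDr scalerA addrACA.
by rewrite scalerN opprD.
Qed.

Lemma wd_linear v m : linear (@wd v m).
Proof.
elim: m => [|m IH] a z w /=; first by rewrite scaler0 addr0.
rewrite !IH; congr (_, _) => /=.
by rewrite scalerBr scalerDr !scalerA [v m * a]mulrC opprD addrACA.
Qed.

HB.instance Definition _ x m :=
  GRing.isLinear.Build R (ext m) (ext m) _ (@bd x m) (@bd_linear x m).
HB.instance Definition _ v m :=
  GRing.isLinear.Build R (ext m) (ext m) _ (@wd v m) (@wd_linear v m).

Lemma bdZ x m a (z : ext m) : bd x (a *: z) = a *: bd x z.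
Proof. by rewrite linearZ_LR. Qed.

Lemma wdZ v m a (z : ext m) : wd v (a *: z) = a *: wd v z.
Proof. by rewrite linearZ_LR. Qed.

Lemma bd_ext1 x m : bd x (ext1 m) = 0.
Proof. by elim: m => //= m ->; rewrite scaler0 addr0 raddf0 oppr0. Qed.

Lemma bd_bd x m (z : ext m) : bd x (bd x z) = 0.
Proof.
elim: m z => //= m IH [a b] /=.
by rewrite !raddfN /= raddfD /= bdZ !IH add0r subrr !oppr0.
Qed.

(** Contraction is an antiderivation, so multiplication by [v] is a homotopy
    from [v_0 x_0 + ... + v_(m-1) x_(m-1)] to zero. *)
Lemma bd_wd x v m (z : ext m) :
  bd x (wd v z) = (\sum_(i < m) v i * x i) *: z - wd v (bd x z).
Proof.
apply: (canRL (addrK _)).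
elim: m z => [|m IH] z /=; first by rewrite big_ord0 scale0r addr0.
have wdE (y t : ext m) : wd v (y + x m *: t) = wd v y + x m *: wd v t.
  by rewrite raddfD /= wdZ.
have bdE (y t : ext m) : bd x (v m *: y - wd v t) =
    v m *: bd x y - bd x (wd v t) by rewrite raddfB /= bdZ.
have wdN (y : ext m) : wd v (- y) = - wd v y by rewrite raddfN.
rewrite wdE bdE wdN big_ord_recr scalerDl; congr (_, _) => /=.
  by rewrite -IH scalerBr !scalerA [x m * _]mulrC addrACA subrK.
by rewrite -IH opprB opprK scalerDr scalerA !addrA subrK addrAC.
Qed.

Lemma wd_lincomb (a b : R) v w m (z : ext m) :
  wd (fun l => a * v l + b * w l) z = a *: wd v z + b *: wd w z.
Proof.
elim: m z => [|m IH] z /=; first by rewrite !scaler0 addr0.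
rewrite !IH; congr (_, _) => /=.
by rewrite scalerDl !scalerBr !scalerA opprD addrACA.
Qed.

Lemma wd_eq0 v m (z : ext m) : (forall l, (l < m)%N -> v l = 0) -> wd v z = 0.
Proof.
elim: m z => [|m IH] z v0 //=.
rewrite !IH ?v0 ?scale0r ?subr0 // => l lm; apply: v0; exact: ltnW.
Qed.

Fixpoint coeffs_in J m : ext m -> Prop :=
  match m return ext m -> Prop with
  | 0 => fun z => J z
  | m'.+1 => fun z => coeffs_in J z.1 /\ coeffs_in J z.2
  end.

Section CoeffsIn.
Variable J : R -> Prop.
Hypothesis iJ : is_ideal J.

Lemma coeffs_in0 m : coeffs_in J (0 : ext m).
Proof. by elim: m => [|m IH] /=; [exact: (ideal0 iJ) | split]. Qed.

Lemma coeffs_inD m (y z : ext m) :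
  coeffs_in J y -> coeffs_in J z -> coeffs_in J (y + z).
Proof.
elim: m y z => [|m IH] y z /=; first exact: (idealD iJ).
by move=> [? ?] [? ?]; split; apply: IH.
Qed.

Lemma coeffs_inZ m a (z : ext m) : coeffs_in J z -> coeffs_in J (a *: z).
Proof.
elim: m z => [|m IH] z /=; first exact: (idealM iJ).
by move=> [? ?]; split; apply: IH.
Qed.

Lemma coeffs_inN m (z : ext m) : coeffs_in J z -> coeffs_in J (- z).
Proof. by rewrite -scaleN1r; apply: coeffs_inZ. Qed.

Lemma coeffs_inB m (y z : ext m) :
  coeffs_in J y -> coeffs_in J z -> coeffs_in J (y - z).
Proof. by move=> Jy Jz; apply: coeffs_inD => //; apply: coeffs_inN. Qed.

End CoeffsIn.

Lemma coeffs_in_scaled (P J : R -> Prop) m a (z : ext m) :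
  (forall f, P f -> J (a * f)) -> coeffs_in P z -> coeffs_in J (a *: z).
Proof.
move=> PJ; elim: m z => [|m IH] z /=; first exact: PJ.
by move=> [? ?]; split; apply: IH.
Qed.

Lemma coeffs_inT m (z : ext m) : coeffs_in (fun=> True) z.
Proof. by elim: m z => //= m IH z; split. Qed.

Lemma coeffs_in_sub (P J : R -> Prop) m (z : ext m) :
  (forall f, P f -> J f) -> coeffs_in P z -> coeffs_in J z.
Proof.
move=> PJ; elim: m z => [|m IH] z /=; first exact: PJ.
by move=> [? ?]; split; apply: IH.
Qed.

Lemma coeffs_in_wd (P J : R -> Prop) v m (z : ext m) : is_ideal J ->
  (forall l f, P f -> J (v l * f)) -> coeffs_in P z -> coeffs_in J (wd v z).
Proof.
move=> iJ PJ; elim: m z => [|m IH] z /=; first by move=> _; apply: (ideal0 iJ).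
move=> [P1 P2]; split; first exact: IH.
apply: coeffs_inB => //; last exact: IH.
exact: coeffs_in_scaled (PJ m) P1.
Qed.

Lemma coeffs_in_bd (P J : R -> Prop) x m (z : ext m) : is_ideal J ->
  (forall l f, P f -> J (x l * f)) -> coeffs_in P z -> coeffs_in J (bd x z).
Proof.
move=> iJ PJ; elim: m z => [|m IH] z /=; first by move=> _; apply: (ideal0 iJ).
move=> [P1 P2]; split; last by apply: coeffs_inN => //; exact: IH.
apply: coeffs_inD => //; first exact: IH.
exact: coeffs_in_scaled (PJ m) P2.
Qed.

Lemma coeffs_in_colon J g m (z : ext m) :
  (forall f, J (g * f) -> J f) -> coeffs_in J (g *: z) -> coeffs_in J z.
Proof.
move=> reg; elim: m z => [|m IH] z /=; first exact: reg.
by move=> [? ?]; split; apply: IH.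
Qed.

Lemma coeffs_in_addp J g m (z : ext m) :
  coeffs_in (addp J g) z -> exists t, coeffs_in J (z - g *: t).
Proof.
elim: m z => [|m IH] z /=.
  by case=> a Ja; exists a; rewrite /GRing.scale /= mulrC.
by move=> [/IH[t1 J1] /IH[t2 J2]]; exists (t1, t2).
Qed.

(** The elements all of whose homogeneous components have degree at least
    [i]; the filtration is enough to see that nothing is left above [m]. *)
Fixpoint deg_ge i m : ext m -> Prop :=
  match m return ext m -> Prop with
  | 0 => fun z => (0 < i)%N -> z = 0
  | m'.+1 => fun z => deg_ge i z.1 /\ deg_ge i.-1 z.2
  end.

Lemma deg_geB i m (y z : ext m) : deg_ge i y -> deg_ge i z -> deg_ge i (y - z).
Proof.
elim: m i y z => [|m IH] i y z /=.
  by move=> y0 z0 ip; rewrite y0 // z0 // subr0.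
by move=> [? ?] [? ?]; split; apply: IH.
Qed.

Lemma deg_geZ i m a (z : ext m) : deg_ge i z -> deg_ge i (a *: z).
Proof.
elim: m i z => [|m IH] i z /=; first by move=> z0 ip; rewrite z0 // scaler0.
by move=> [? ?]; split; apply: IH.
Qed.

Lemma deg_ge0 m (z : ext m) : deg_ge 0 z.
Proof. by elim: m z => //= m IH z; split. Qed.

Lemma deg_ge_wd i v m (z : ext m) : deg_ge i z -> deg_ge i.+1 (wd v z).
Proof.
elim: m i z => [|m IH] i z //= [z1 z2]; split; first exact: IH.
apply: deg_geB; first exact: deg_geZ.
by case: i z2 {z1} => [_|i /IH] //; apply: deg_ge0.
Qed.

Lemma deg_ge_eq0 i m (z : ext m) : (m < i)%N -> deg_ge i z -> z = 0.
Proof.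
elim: m i z => [|m IH] i z /=; first by move=> ip; apply.
case: z => a b mi /= [a0 b0].
by rewrite (IH _ _ (ltnW mi) a0) (IH _ _ _ b0) // -ltnS; case: i mi {a0 b0}.
Qed.

(** If [r] elements of the ideal [(x)] form a regular sequence on [R/J], then
    the Koszul homology of [R/J] vanishes in degrees above [m - r].  For the
    first element [f], the homotopy [h] of [f] turns a cycle [z] into
    [f z = d(h z)] modulo [J]; so [h z] is a cycle modulo [J + (f)], of degree
    one more, hence of the form [d(u) + f t] modulo [J], and cancelling [f] in
    [f z = f d(t)] exhibits [z] as the boundary of [t]. *)
Lemma koszul_vanishing x m J s i (z : ext m) : is_ideal J ->
  (forall f, f \in s -> exists v, f = \sum_(l < m) v l * x l) ->
  wreg J s -> (m < i + size s)%N -> deg_ge i z -> coeffs_in J (bd x z) ->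
  exists u, coeffs_in J (z - bd x u).
Proof.
elim: s J i z => [|f s IH] J i z iJ.
  move=> _ _; rewrite addn0 => mi /(deg_ge_eq0 mi) -> _.
  by exists 0; rewrite raddf0 subrr; apply: coeffs_in0.
move=> sx [reg wr] mi iz Jz.
have [v fE] := sx f (mem_head f s).
have Jwz : coeffs_in J (wd v (bd x z)).
  by apply: coeffs_in_wd Jz => // l g; apply: idealM.
have dwz : bd x (wd v z) = f *: z - wd v (bd x z) by rewrite fE; apply: bd_wd.
have [u Ju] : exists u, coeffs_in (addp J f) (wd v z - bd x u).
  apply: (IH _ i.+1) => //.
  - exact: addp_ideal.
  - by move=> g gs; apply: sx; rewrite inE gs orbT.
  - by rewrite addSnnS.
  - exact: deg_ge_wd.
  rewrite dwz; apply: coeffs_inB; first exact: addp_ideal.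
    apply: coeffs_in_scaled (coeffs_inT z) => g _.
    by rewrite mulrC; apply: mem_addp.
  by apply: coeffs_in_sub Jwz => g; apply: sub_addp.
have [t Jt] := coeffs_in_addp Ju; exists t.
apply: (coeffs_in_colon reg).
have -> : f *: (z - bd x t) = bd x (wd v z - bd x u - f *: t) + wd v (bd x z).
  by rewrite !raddfB /= bd_bd subr0 bdZ dwz addrAC subrK.
apply: coeffs_inD => //; apply: coeffs_in_bd Jt => // l g; exact: idealM.
Qed.

End Koszul.

(** * Monomial ideals *)

Section MonomialIdeals.
Variables (K : fieldType) (n : nat).
Local Notation S := {mpoly K[n]}.
Implicit Types (P Q : 'X_{1..n} -> Prop) (m g : 'X_{1..n}) (J : S -> Prop).

Definition mon_ideal P : S -> Prop := fun f => forall m, m \in msupp f -> P m.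

Definition upclosed P := forall m m', P m -> P (m + m')%MM.

Lemma mon_ideal_ideal P : upclosed P -> is_ideal (mon_ideal P).
Proof.
move=> upP; split=> [m|f g Pf Pg m /msuppD_le|a f Pf m].
- by rewrite msupp0.
- by rewrite mem_cat => /orP[/Pf|/Pg].
case/msuppM_le/allpairsP=> -[m1 m2] /= [_ /Pf Pm2 ->].
by rewrite addmC; apply: upP.
Qed.

Lemma mon_idealM P Q T (f g : S) :
  (forall m m', P m -> Q m' -> T (m + m')%MM : Prop) ->
  mon_ideal P f -> mon_ideal Q g -> mon_ideal T (f * g).
Proof.
move=> PQT Pf Qg m /msuppM_le/allpairsP[[m1 m2] /= [/Pf P1 /Qg Q2 ->]].
exact: PQT.
Qed.

Lemma mon_idealX P m : mon_ideal P 'X_[m] <-> P m.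
Proof.
split=> [|Pm m']; first by apply; rewrite msuppX mem_head.
by rewrite msuppX inE => /eqP ->.
Qed.

Lemma mon_ideal_sub P Q : (forall m, P m -> Q m) ->
  forall f, mon_ideal P f -> mon_ideal Q f.
Proof. by move=> PQ f Pf m /Pf/PQ. Qed.

Lemma eq_mon_ideal P Q :
  (forall m, P m <-> Q m) -> eq_ideal (mon_ideal P) (mon_ideal Q).
Proof. by move=> PQ f; split; apply: mon_ideal_sub => m /PQ. Qed.

Lemma ideal_monomials J (f : S) : is_ideal J ->
  (forall m, m \in msupp f -> J 'X_[m]) -> J f.
Proof.
move=> iJ Jf; rewrite [f]mpolyE big_seq; apply: ideal_sum => // m mf.
by rewrite -mul_mpolyC; apply: idealM => //; apply: Jf.
Qed.

Lemma colon_mon_ideal P g :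
  eq_ideal (colon (mon_ideal P) 'X_[g]) (mon_ideal (fun m => P (m + g)%MM)).
Proof.
move=> f; rewrite /colon mulrC; split=> Pf m.
  move=> mf; apply: Pf; rewrite (perm_mem (msuppMX _ _)) addmC.
  exact: map_f.
rewrite (perm_mem (msuppMX _ _)) => /mapP[m' mf ->].
by rewrite addmC; apply: Pf.
Qed.

Lemma addp_mon_ideal P g : upclosed P ->
  eq_ideal (addp (mon_ideal P) 'X_[g])
    (mon_ideal (fun m => P m \/ (g <= m)%MM)).
Proof.
move=> upP; have iP := mon_ideal_ideal upP.
have upPg : upclosed (fun m => P m \/ (g <= m)%MM).
  move=> m m' [/upP Pm|gm]; [by left | right].
  by apply: lepm_trans gm _; apply: lem_addr.
move=> f; split.
  apply: addp_min; first exact: mon_ideal_ideal.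
    by apply: mon_ideal_sub => m; left.
  by apply/mon_idealX; right; apply: lepm_refl.
move=> Pf; apply: ideal_monomials => [|m /Pf[Pm|gm]].
- exact: addp_ideal.
- by apply: sub_addp; apply/mon_idealX.
by rewrite -(submK gm) mpolyXD; apply: mem_addp.
Qed.

Lemma wreg_mon_split P g s : upclosed P ->
  wreg (mon_ideal (fun m => P (m + g)%MM)) s ->
  wreg (mon_ideal (fun m => P m \/ (g <= m)%MM)) s -> wreg (mon_ideal P) s.
Proof.
move=> upP wc wa; apply: (wreg_split (g := 'X_[g])); 
  first exact: mon_ideal_ideal.
  by apply: eq_wreg wc => f; apply: iff_sym; exact: colon_mon_ideal.
by apply: eq_wreg wa => f; apply: iff_sym; exact: addp_mon_ideal.
Qed.

Lemma eq_wreg_mon P Q s : (forall m, P m <-> Q m) ->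
  wreg (mon_ideal P) s -> wreg (mon_ideal Q) s.
Proof. by move=> PQ; apply/eq_wreg/eq_mon_ideal. Qed.

(** The exponents of the monomials in the prime ideal generated by the
    variables in [A]. *)
Definition has_var (A : {set 'I_n}) m := exists2 i, i \in A & (0 < m i)%N.

Lemma has_var_up A : upclosed (has_var A).
Proof.
by move=> m m' [i iA mi]; exists i => //; rewrite mnmDE addn_gt0 mi.
Qed.

Lemma has_var1 (A : {set 'I_n}) i m :
  has_var (i |: A) m <-> has_var A m \/ (U_(i) <= m)%MM.
Proof.
rewrite lep1mP -lt0n; split=> [[j]|[[j jA mj]|mi]].
- by rewrite !inE => /predU1P[->|jA] mj; [right | left; exists j].
- by exists j => //; rewrite !inE jA orbT.
by exists i => //; rewrite !inE eqxx.
Qed.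

Lemma has_varD (A : {set 'I_n}) m g :
  ~ has_var A g -> has_var A (m + g)%MM <-> has_var A m.
Proof.
move=> Ag; split=> [[i iA]|]; last exact: has_var_up.
rewrite mnmDE addn_gt0 => /orP[mi|gi]; first by exists i.
by case: Ag; exists i.
Qed.

(** Splitting off the variables of a monomial [g] one by one filters
    [S/(x_A, x^g)] by quotients modulo [x_A] and one variable of [g]. *)
Lemma wreg_monomial (A : {set 'I_n}) g s : ~ has_var A g ->
  (forall i, (0 < g i)%N -> wreg (mon_ideal (has_var (i |: A))) s) ->
  wreg (mon_ideal (fun m => has_var A m \/ (g <= m)%MM)) s.
Proof.
have upAg h : upclosed (fun m => has_var A m \/ (h <= m)%MM).
  move=> m m' [/has_var_up Am|hm]; [by left; apply: Am | right].
  by apply: lepm_trans hm _; apply: lem_addr.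
elim: {g}(mdeg g) {-2}g (erefl (mdeg g)) => [|k IH] g gk Ag Ai.
  move/eqP: gk; rewrite mdeg_eq0 => /eqP ->.
  apply: wreg1; first exact: mon_ideal_ideal.
  by rewrite -mpolyX0; apply/mon_idealX; right; apply: lepm_refl.
have [i gi] : exists i, (0 < g i)%N.
  case: (altP (g =P 0%MM)) => [g0|]; first by rewrite g0 mdeg0 in gk.
  move=> g0; apply/existsP; apply: contraR g0 => /existsPn g0.
  by apply/eqP/mnmP => i; rewrite mnm0E; apply/eqP; rewrite -leqn0 leqNgt.
have U1g : (U_(i) <= g)%MM by rewrite lep1mP -lt0n.
have gE := submK U1g; set h := (g - U_(i))%MM in gE.
have Ah : ~ has_var A h.
  by case=> j jA hj; apply: Ag; exists j; rewrite -?gE ?mnmDE ?addn_gt0 ?hj.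
have Aj : ~ has_var A U_(i)%MM.
  case=> j jA; rewrite mnm1E lt0b => /eqP ij; apply: Ag.
  by exists j => //; rewrite -ij.
apply: (wreg_mon_split (g := U_(i)%MM)) => //.
  have hk : mdeg h = k by move: gk; rewrite -gE mdegD mdeg1 addn1 => -[].
  apply: eq_wreg_mon (IH _ hk Ah _) => [m|j hj].
    rewrite has_varD // -gE; split=> -[?|hm]; (try by left); right.
      by apply/mnm_lepP => j; rewrite !mnmDE leq_add2r; apply/mnm_lepP.
    apply/mnm_lepP => j; move/mnm_lepP/(_ j): hm.
    by rewrite !mnmDE leq_add2r.
  by apply: Ai; rewrite -gE mnmDE addn_gt0 hj.
apply: eq_wreg_mon (Ai i gi) => m; rewrite has_var1; split=> [[]|[[]|]]; auto.
by move=> gm; right; apply: lepm_trans gm.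
Qed.

End MonomialIdeals.

(** * Elementary symmetric polynomials modulo sets of variables *)

Section Graded.
Variables (K : fieldType) (n : nat).
Local Notation S := {mpoly K[n]}.
Implicit Types (J : S -> Prop) (f g h : S).

Definition graded J := forall d f, J f -> J (pihomog mdeg d f).

Lemma mon_ideal_graded P : upclosed P -> graded (@mon_ideal K n P).
Proof.
move=> upP d f Pf; have iP := mon_ideal_ideal K upP.
rewrite pihomogE big_seq_cond; apply: ideal_sum => // m /andP[mf _].
by rewrite -mul_mpolyC; apply: (idealM iP); apply/mon_idealX/Pf.
Qed.

Lemma addp_graded J e f : is_ideal J -> f \is e.-homog -> graded J ->
  graded (addp J f).
Proof.
move=> iJ fe gJ d g [a Ja].
have [b bE] : exists b, pihomog mdeg d (a * f) = b * f.
  exists (\sum_(i < msize a | (i + e)%N == d) pihomog mdeg i a).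
  rewrite {1}(pihomog_partitionE (mf := mdeg) (leqnn (msize a))).
  rewrite mulr_suml raddf_sum /= mulr_suml [RHS]big_mkcond /=.
  apply: eq_bigr => i _.
  have aif : pihomog mdeg i a * f \is (i + e).-homog.
    by apply: dhomogM => //; apply: pihomogP.
  by case: eqP => [<-|/eqP ne]; [apply: pihomog_dE | apply: pihomog_ne0 ne _].
by exists b; rewrite -bE -pihomogB; apply: gJ.
Qed.

(** A form of Krull's intersection theorem: in degrees below [N] the ideals [J]
    and [J + (x_b^N)] agree. *)
Lemma graded_closed J b h : is_ideal J -> graded J ->
  (forall N, addp J ('X_b ^+ N) h) -> J h.
Proof.
move=> iJ gJ Jh; rewrite (pihomog_partitionE (mf := mdeg) (leqnn (msize h))).
apply: ideal_sum => // d _; have [a Ja] := Jh (msize h).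
have := gJ d _ Ja; rewrite pihomogB.
suff -> : pihomog mdeg d (a * 'X_b ^+ msize h) = 0 by rewrite subr0.
rewrite pihomogE big_seq_cond big_pred0 // => m; apply/negP => /andP[].
rewrite mpolyXn => /msuppM_le/allpairsP[[m1 m2] /= [_]].
rewrite msuppX inE => /eqP -> -> /eqP; rewrite mdegD mdegMn mdeg1 mul1n.
by move: (ltn_ord d) => /[swap] <-; rewrite ltnNge leq_addl.
Qed.

(** A homogeneous sequence that is regular modulo a regular variable [x_b] is
    regular: by induction on [N] it is regular modulo [J + (x_b^N)]. *)
Lemma wreg_lift J b (s : seq S) : is_ideal J -> graded J ->
  (forall h, J ('X_b * h) -> J h) ->
  (forall f, f \in s -> exists e, f \is e.-homog) ->
  wreg (addp J 'X_b) s -> wreg J s.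
Proof.
move=> iJ gJ reg hs wr.
have wrN N : wreg (addp J ('X_b ^+ N)) s.
  elim: N => [|N IH].
    apply: wreg1; first exact: addp_ideal.
    by rewrite expr0; apply: addp_self.
  apply: (wreg_split (g := 'X_b)); first exact: addp_ideal.
    apply: eq_wreg IH => h; split=> -[a Ja]; exists a.
      have -> : 'X_b * h - a * 'X_b ^+ N.+1 = 'X_b * (h - a * 'X_b ^+ N).
        by rewrite exprS; ring.
      exact: idealM.
    by apply: reg; rewrite mulrBr mulrCA -exprS.
  apply: eq_wreg wr => h; split=> [|/addpC].
    apply: addp_min; first exact/addp_ideal/addp_ideal.
      by move=> g Jg; do 2! apply: sub_addp.
    exact/addp_self/addp_ideal.
  apply: addp_min => //; first exact: addp_ideal.
  by rewrite exprSr; apply: mem_addp.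
elim: s J iJ gJ hs wrN {reg wr} => //= f s IH J iJ gJ hs wrN; split.
  move=> g Jg; apply: (@graded_closed _ b) => // N.
  by case: (wrN N) => + _; apply; apply: sub_addp.
have [e fe] := hs f (mem_head f s).
apply: IH => [|||N]; first exact: addp_ideal.
- exact: addp_graded fe gJ.
- by move=> g gs; apply: hs; rewrite inE gs orbT.
by case: (wrN N) => _; apply: eq_wreg => g; split; apply: addpC.
Qed.

(** The order of the degrees matters: in exactly [d] variables, the first
    member [x_1 ... x_d] allows an induction on [d]. *)
Fixpoint esyms d : seq S :=
  if d is d'.+1 then mesym n K d :: esyms d' else [::].

Lemma size_esyms d : size (esyms d) = d.
Proof. by elim: d => //= d ->. Qed.

Lemma mem_esyms d f : f \in esyms d -> exists2 e, (0 < e)%N & f = mesym n K e.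
Proof.
elim: d => //= d IH; rewrite inE => /predU1P[->|/IH //].
by exists d.+1.
Qed.

(** A squarefree monomial of degree [d] that does not involve [A], when the
    complement of [A] has [d] elements, is the product of that complement. *)
Lemma mesym_mod_vars (A : {set 'I_n}) d : (#|A| + d = n)%N ->
  mon_ideal (has_var A) (mesym n K d - 'X_[mesym1 (~: A)]).
Proof.
move=> Ad; rewrite mesymE (bigD1 (~: A)) /=; last first.
  by rewrite -(eqn_add2l #|A|) cardsC card_ord Ad.
rewrite [X in X - _]addrC addrK.
apply: ideal_sum => [|h /andP[/eqP hd hA]].
  exact/mon_ideal_ideal/has_var_up.
apply/mon_idealX; have [i ih iA] : exists2 i, i \in h & i \in A.
  have /subsetPn[i ih] : ~~ (h \subset ~: A); last first.
    by rewrite inE negbK; exists i.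
  apply: contra hA => hA; rewrite eqEcard hA /= hd.
  by rewrite -(leq_add2l #|A|) cardsC card_ord Ad.
by exists i => //; rewrite mnmE ih.
Qed.

(** Modulo any set [A] of variables, the elementary symmetric polynomials of
    degrees [d, ..., 1] in [n] variables become those in the remaining ones,
    so that they form a regular sequence when these are at least [d].  If
    there are exactly [d], the one of degree [d] is their product, which
    vanishes where one of them does, and one proceeds to degree [d - 1] with
    that variable in [A].  If there are more, one of them is added to [A]. *)
Lemma wreg_esyms d (A : {set 'I_n}) :
  (#|A| + d <= n)%N -> wreg (mon_ideal (has_var A)) (esyms d).
Proof.
elim: d A => //= d IHd A.
have iA B : is_ideal (@mon_ideal K n (has_var B)).
  exact/mon_ideal_ideal/has_var_up.
have notin (B : {set 'I_n}) i : i \notin B -> ~ has_var B U_(i)%MM.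
  by move=> iNB [j jB]; rewrite mnm1E lt0b => /eqP ij; rewrite ij jB in iNB.
move=> Ad; have [k kE] : exists k, (#|A| + d.+1 + k = n)%N.
  by exists (n - (#|A| + d.+1))%N; rewrite subnKC.
elim: k A Ad kE => [|k IH] A Ad kE.
  have Ad1 : (#|A| + d.+1 = n)%N by move: kE; rewrite addn0.
  have JE := mesym_mod_vars Ad1; set e := mesym _ _ _ in JE *.
  set g := mesym1 _ in JE.
  have nA : ~ has_var A g by case=> i iA'; rewrite mnmE inE iA'.
  split=> [h Jeh|].
    suff /colon_mon_ideal : colon (mon_ideal (has_var A)) 'X_[g] h.
      by apply: mon_ideal_sub => m; rewrite has_varD.
    rewrite /colon; have -> : 'X_[g] * h = e * h - h * (e - 'X_[g]) by ring.
    by apply: (idealB (iA A)) => //; apply: (idealM (iA A)).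
  have : wreg (mon_ideal (fun m => has_var A m \/ (g <= m)%MM)) (esyms d).
    apply: wreg_monomial => // i; rewrite mnmE inE lt0b => iNA.
    by apply: IHd; rewrite cardsU1 iNA add1n addSnnS.
  apply: eq_wreg => f.
  apply: iff_trans (iff_sym (addp_mon_ideal _ (@has_var_up _ A) f)) _.
  split; apply: addp_min; try exact: addp_ideal; try exact: sub_addp.
    by exists 1; rewrite mul1r -opprB; apply: (idealN (iA A)).
  by exists 1; rewrite mul1r.
have [b bA] : exists b, b \notin A.
  apply/existsP; rewrite -negb_forall; apply/negP => /forallP allA.
  have : (n <= #|A|)%N.
    by rewrite -{1}(card_ord n) -cardsT; apply/subset_leq_card/subsetP.
  by rewrite leqNgt (leq_trans _ Ad) // addnS ltnS leq_addr.
have nA := notin A b bA.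
apply: (@wreg_lift (mon_ideal (has_var A)) b (esyms d.+1)) => //.
- by apply: mon_ideal_graded; apply: has_var_up.
- move=> h /colon_mon_ideal; apply: mon_ideal_sub => m.
  by rewrite has_varD.
- move=> f fs; have [|e _ ->] := @mem_esyms d.+1 f; first by [].
  by exists e; apply: dhomog_mesym.
have : wreg (mon_ideal (has_var (b |: A))) (esyms d.+1).
  have cA : (#|b |: A| + d.+1 + k = n)%N.
    by rewrite cardsU1 bA add1n !addSn -addnS.
  by apply: IH; first by move: (leq_addr k (#|b |: A| + d.+1)); rewrite cA.
apply: eq_wreg => f.
apply: iff_trans (iff_sym (addp_mon_ideal _ (@has_var_up _ A) f)).
by apply: eq_mon_ideal => m; apply: has_var1.
Qed.

End Graded.

(** * Powers of the complementary edge ideal of a path *)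

(** Exponents of the monomials in [I_c(P_(r+2))^k], in the variables [x_0, ...,
    x_(r+1)]; the ideal of a single edge is [S].  The generators of
    [I_c(P_(r+3))] are those of [I_c(P_(r+2))] times [x_(r+2)], and
    [x_0 ... x_r]; so its [k]-th power is the sum over [j] of the ideals
    [x_(r+2)^j (x_0 ... x_r)^(k-j) I_c(P_(r+2))^j]. *)
Fixpoint path_exp r k (e : nat -> nat) : Prop :=
  if r is r'.+1 then
    exists j, [/\ (j <= k)%N, (j <= e r'.+2)%N,
      forall i, (i <= r')%N -> (k - j <= e i)%N
      & path_exp r' j (fun i => e i - (i <= r') * (k - j))%N]
  else True.

Lemma path_exp_mono r k e e' : (forall i, (i <= r.+1)%N -> (e i <= e' i)%N) ->
  path_exp r k e -> path_exp r k e'.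
Proof.
elim: r k e e' => //= r IH k e e' ee' [j [jk je ke Pj]]; exists j; split=> //.
- exact: leq_trans (ee' _ _).
- by move=> i ir; apply: leq_trans (ke i ir) (ee' _ _); lia.
by apply: IH Pj => i ir; apply: leq_sub2r; apply: ee'; lia.
Qed.

Lemma path_exp0 r e : path_exp r 0 e.
Proof. by elim: r e => //= r IH e; exists 0%N; split. Qed.

Lemma path_expD r j k e e' : path_exp r j e -> path_exp r k e' ->
  path_exp r (j + k) (fun i => e i + e' i)%N.
Proof.
elim: r j k e e' => //= r IH j k e e' [j' [jj je le Pj]] [k' [kk ke le' Pk]].
exists (j' + k')%N; split; try lia.
  by move=> i ir; have := le i ir; have := le' i ir; lia.
apply: path_exp_mono (IH _ _ _ _ Pj Pk) => i _.
case: (leqP i r) => ir; rewrite ?mul0n ?mul1n.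
  by have := le i ir; have := le' i ir; lia.
by lia.
Qed.

Lemma path_exp_gen r a e : (a <= r)%N ->
  (forall i, (i <= r.+1)%N -> i != a -> i != a.+1 -> (0 < e i)%N) ->
  path_exp r 1 e.
Proof.
elim: r e => //= r IH e; rewrite leq_eqVlt => /predU1P[-> e1|ar e1].
  exists 0%N; split=> //; last exact: path_exp0.
  by move=> i ir; rewrite subn0; apply: e1; lia.
exists 1%N; split=> //; first by apply: e1; lia.
apply: path_exp_mono (IH e _ _) => [i _|//|i ir].
  by rewrite subnn muln0 subn0.
by apply: e1; lia.
Qed.

Lemma path_exp_scale r c : path_exp r c (fun i => (i <= r) * c)%N.
Proof.
elim: c => [|c IH]; first exact: path_exp0.
have P1 : path_exp r 1 (fun i => (i <= r)%N : nat).
  by apply: (@path_exp_gen _ r) => // i ir ni ni'; lia.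
rewrite -add1n; apply: path_exp_mono (path_expD P1 IH) => i _.
by case: (i <= r)%N; lia.
Qed.

(** The exponents of [(x_0 ... x_r)^(k-t) I_c(P_(r+2))^t]. *)
Definition path_slice r k t (e : nat -> nat) :=
  (forall i, (i <= r)%N -> (k - t <= e i)%N) /\
  path_exp r t (fun i => e i - (i <= r) * (k - t))%N.

(** These ideals grow with [t], since [x_0 ... x_r] is in [I_c(P_(r+2))]. *)
Lemma path_slice_le r k j t e : (j <= t <= k)%N ->
  path_slice r k j e -> path_slice r k t e.
Proof.
move=> /andP[jt tk] [le Pj]; split=> [i /le|]; first by lia.
have := path_expD Pj (path_exp_scale r (t - j)); rewrite subnKC //.
apply: path_exp_mono => i _.
by case: (leqP i r) => ir; rewrite ?mul0n ?mul1n; [have := le i ir|]; lia.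
Qed.

Section PathMonomials.
Variables (K : fieldType) (n : nat).
Local Notation S := {mpoly K[n]}.

Definition exponent (m : 'X_{1..n}) (i : nat) : nat := nth 0%N m i.

Lemma exponent_ord (m : 'X_{1..n}) (i : 'I_n) : exponent m i = m i.
Proof. by rewrite (mnm_nth 0%N). Qed.

Lemma exponentD (m m' : 'X_{1..n}) i :
  exponent (m + m')%MM i = (exponent m i + exponent m' i)%N.
Proof.
case: (ltnP i n) => [lt_in|le_ni].
  by rewrite -[i]/(nat_of_ord (Ordinal lt_in)) !exponent_ord mnmDE.
by rewrite /exponent !nth_default ?size_tuple.
Qed.

(** In the step from [r] to [r + 1], let [x = x_(r+2)], [J = I_c(P_(r+3))^k],
    and for [t <= k] let [A_t] be [(x_0 ... x_r)^(k-t) I_c(P_(r+2))^t], so that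
    [J] is the sum of the [x^t A_t] and [A_t] increases with [t].  Then
    [(J : x^t) + (x) = A_t + (x)], and [J : x^k = A_k] is extended from the
    shorter path.  For [t < k], splitting off the monomial factor of [A_t]
    leaves the power [t] of the ideal of the shorter path, modulo [x], and
    quotients modulo [x] and one other variable.  The variables in [A] are
    those which have been set to zero in this way; they lie beyond the path. *)
Lemma wreg_path r k d (A : {set 'I_n}) : (r.+2 <= n)%N ->
  (forall i, i \in A -> (r.+2 <= i)%N) ->
  (#|A| + d + r.+2 <= n + maxn (r.+1 - k) 1)%N ->
  wreg (@mon_ideal K n (fun m => has_var A m \/ path_exp r k (exponent m)))
    (esyms K n d).
Proof.
have upP r' k' (B : {set 'I_n}) :
    upclosed (fun m => has_var B m \/ path_exp r' k' (exponent m)).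
  move=> m m' [/has_var_up Bm|Pm]; [by left; apply: Bm | right].
  by apply: path_exp_mono Pm => i _; rewrite exponentD leq_addr.
have unit r' k' (B : {set 'I_n}) : path_exp r' k' (exponent 0%MM) ->
    wreg (@mon_ideal K n (fun m => has_var B m \/ path_exp r' k' (exponent m)))
      (esyms K n d).
  move=> P0; apply: wreg1; first exact: mon_ideal_ideal.
  by rewrite -mpolyX0; apply/mon_idealX; right.
elim: r k A => [|r IH] k A rn Ar Ad; first exact: unit.
case: (posnP k) => [k0|kp]; first by apply: unit; rewrite k0; apply: path_exp0.
pose i0 := Ordinal rn; have i0A : i0 \notin A.
  by apply/negP => /Ar; rewrite ltnn.
have cA0 : #|i0 |: A| = #|A|.+1 by rewrite cardsU1 i0A.
pose C t m := has_var A m \/ exists j,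
  [/\ (j <= k)%N, (j <= exponent m r.+2 + t)%N & path_slice r k j (exponent m)].
have slice_mono t (m m' : 'X_{1..n}) :
    (forall i, (i <= r.+1)%N -> (exponent m i <= exponent m' i)%N) ->
    path_slice r k t (exponent m) -> path_slice r k t (exponent m').
  move=> le [le1 P]; split=> [i ir|].
    by apply: leq_trans (le1 i ir) (le i _); lia.
  by apply: path_exp_mono P => i ir; apply: leq_sub2r; apply: le.
have Cup t : upclosed (C t).
  move=> m m' [/has_var_up Am|[j [jk je Pj]]]; [by left; apply: Am | right].
  exists j; split=> //; first by rewrite exponentD; lia.
  by apply: slice_mono Pj => i _; rewrite exponentD leq_addr.
suff wrC c t : (t + c = k)%N -> wreg (@mon_ideal K n (C t)) (esyms K n d).
  apply: eq_wreg_mon (wrC k 0%N (add0n k)) => m; rewrite /C /=.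
  split=> -[Am|[j]]; try by left.
    by rewrite addn0 => -[jk jm [? ?]]; right; exists j; split.
  by move=> [jk jm ? ?]; right; exists j; rewrite addn0; split.
(* [C t] is [J : x^t], and [c = k - t] splittings by [x] remain. *)
elim: c t => [|c IHc] t tk.
  rewrite addn0 in tk; rewrite tk.
  apply: eq_wreg_mon (IH k A (ltnW rn) _ _) => [m|i /Ar/ltnW //|]; last first.
    by move: #|A| Ad => a; lia.
  split=> -[|Pm]; try by left.
    right; exists k; split=> //; first by rewrite leq_addl.
    split=> [i|]; first by rewrite subnn.
    by apply: path_exp_mono Pm => i _; rewrite subnn muln0 subn0.
  right; case: Pm => j [jk _ /(@path_slice_le _ _ _ k) [|_]].
    by rewrite jk leqnn.
  by apply: path_exp_mono => i _; rewrite leq_subr.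
have i0E i : (i <= r.+1)%N -> exponent U_(i0)%MM i = 0%N.
  move=> ir; have lt_in : (i < n)%N by lia.
  rewrite -[i]/(nat_of_ord (Ordinal lt_in)) exponent_ord mnm1E -val_eqE /=.
  by case: eqP => //; lia.
apply: (wreg_mon_split (g := U_(i0)%MM)) => //.
  apply: eq_wreg_mon (IHc t.+1 _) => [m|]; last by lia.
  have AU : ~ has_var A U_(i0)%MM.
    by case=> j jA; rewrite mnm1E lt0b => /eqP ij; rewrite ij jA in i0A.
  rewrite /C has_varD // exponentD.
  rewrite -[r.+2]/(nat_of_ord i0) !exponent_ord mnm1E eqxx.
  rewrite addn1 addSnnS; split=> -[|[j [? ? Pj]]]; (try by left); right.
    by exists j; split=> //; apply: slice_mono Pj => i _;
      rewrite exponentD leq_addr.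
  exists j; split=> //; apply: slice_mono Pj => i ir.
  by rewrite exponentD i0E // addn0.
(* Modulo [x], the ideal [J : x^t] is [A_t]; its monomial factor is [g]. *)
pose A' := i0 |: A; pose g := [multinom ((i <= r) * (k - t))%N | i < n].
have gE i : (i <= r.+1)%N -> exponent g i = ((i <= r) * (k - t))%N.
  move=> ir; have lt_in : (i < n)%N by lia.
  by rewrite -[i]/(nat_of_ord (Ordinal lt_in)) exponent_ord mnmE.
have A'r i : i \in A' -> (r.+2 <= i)%N.
  by rewrite !inE => /predU1P[->|/Ar/ltnW].
have A'g : ~ has_var A' g.
  case=> i /A'r ri; rewrite mnmE; case: leqP => //; lia.
suff wr : wreg (@mon_ideal K n
    (fun m => has_var A' m \/ path_slice r k t (exponent m))) (esyms K n d).
  apply: eq_wreg_mon wr => m; rewrite has_var1; split.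
    case=> [[Am|i0m]|Pm]; [by left; left | by right |].
    by left; right; exists t; split=> //; lia.
  case=> [[Am|[j [jk jt Pj]]]|i0m]; [by left; left | | by left; right].
  case: (posnP (exponent m r.+2)) => [m0|mp]; last first.
    left; right; rewrite lep1mP -lt0n; move: mp.
    by rewrite -[r.+2]/(nat_of_ord i0) exponent_ord.
  right; apply: path_slice_le Pj; move: jt; rewrite m0 add0n => ->; lia.
apply: (wreg_mon_split (g := g)).
- move=> m m' [/has_var_up Am|Pm]; [by left; apply: Am | right].
  by apply: slice_mono Pm => i _; rewrite exponentD leq_addr.
- apply: eq_wreg_mon (IH t A' (ltnW rn) A'r _) => [m|]; last first.
    by rewrite cA0; move: #|A| Ad => a; lia.
  rewrite has_varD //; split=> -[|Pm]; (try by left); right.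
    split=> [i ir|]; first by rewrite exponentD gE ?ir ?mul1n ?leq_addl //; lia.
    by apply: path_exp_mono Pm => i ir; rewrite exponentD gE // addnK.
  case: Pm => _; apply: path_exp_mono => i ir.
  by rewrite exponentD gE // addnK.
have wr : wreg (@mon_ideal K n (fun m => has_var A' m \/ (g <= m)%MM))
    (esyms K n d).
  apply: wreg_monomial => // i; rewrite mnmE => gi; apply: wreg_esyms.
  have iA' : i \notin A'.
    by apply/negP => /A'r ri; move: gi; case: leqP => // ir; lia.
  by rewrite cardsU1 iA' cA0; move: #|A| Ad => a; lia.
apply: eq_wreg_mon wr => m; split=> [[|]|[[|[le _]]|]]; auto.
right; apply/mnm_lepP => i; rewrite mnmE -exponent_ord.
by case: (leqP i r) => // ir; rewrite mul1n; apply: le.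
Qed.

End PathMonomials.

Section PathIdeal.
Variables (K : fieldType) (n : nat).
Local Notation S := {mpoly K[n]}.
Local Notation I := (compl_edge_ideal K (path_graph n)).
Implicit Types (f g : S).

Definition edge_mon a : S :=
  \prod_(l < n | (l != a :> nat) && (l != a.+1 :> nat)) 'X_l.

Definition edge_exp a : 'X_{1..n} :=
  [multinom ((l != a :> nat) && (l != a.+1 :> nat) : nat) | l < n].

Lemma edge_monE a : edge_mon a = 'X_[edge_exp a].
Proof.
rewrite mpolyXE_id /edge_mon big_mkcond; apply: eq_bigr => l _.
by rewrite mnmE; case: ifP => _; rewrite ?expr1 ?expr0.
Qed.

Lemma mdeg_edge_exp a : (a.+1 < n)%N -> mdeg (edge_exp a) = (n - 2)%N.
Proof.
move=> an; have an' := ltnW an.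
pose i := Ordinal an'; pose j := Ordinal an.
have ij : i != j by rewrite -val_eqE /= neq_ltn ltnSn.
have := cardsC [set i; j]; rewrite cards2 ij card_ord /= => nE.
have -> : (n - 2 = #|~: [set i; j]|)%N by rewrite -[in LHS]nE addKn.
rewrite mdegE -sum1_card [RHS]big_mkcond; apply: eq_bigr => l _.
by rewrite mnmE !inE negb_or -!val_eqE /=; case: ifP.
Qed.

Lemma mem_edge_mon a : (a.+1 < n)%N -> I (edge_mon a).
Proof.
move=> an; apply: mem_ideal_gen; exists (Ordinal (ltnW an)), (Ordinal an).
by rewrite /= /path_adj /= eqxx.
Qed.

Lemma path_ideal_min (J : S -> Prop) : is_ideal J ->
  (forall a, (a.+1 < n)%N -> J (edge_mon a)) -> forall f, I f -> J f.
Proof.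
move=> iJ Ja; apply: ideal_gen_min => // f [i [j [/orP[]/eqP ij ->]]].
  have := Ja i; rewrite -ij => /(_ (ltn_ord j)); congr J.
  by apply: eq_bigl => l; rewrite -ij.
have := Ja j; rewrite -ij => /(_ (ltn_ord i)); congr J.
by apply: eq_bigl => l; rewrite -ij andbC.
Qed.

Lemma edge_mon_factor a c (e : nat -> nat) :
  (forall l, (l < n)%N -> l != a -> l != a.+1 -> (c <= e l)%N) ->
  \prod_(l < n) 'X_l ^+ e l = edge_mon a ^+ c *
    \prod_(l < n) 'X_l ^+ (e l - ((l != a :> nat) && (l != a.+1 :> nat)) * c)
  :> S.
Proof.
move=> ce; rewrite /edge_mon [X in X ^+ c]big_mkcond -prodrXl -big_split.
apply: eq_bigr => l _ /=; have := ce l (ltn_ord l).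
case: ifP => [/andP[-> ->] le|_ _]; last by rewrite expr1n mul1r subn0.
by rewrite mul1n -exprD subnKC //; apply: le.
Qed.

(** A generator for an edge among the first [r + 2] vertices involves all the
    variables beyond them, which is why [e'] has to be at least [k] there. *)
Lemma path_exp_mem r k (e e' : nat -> nat) : (r.+2 <= n)%N -> path_exp r k e ->
  (forall i, (i <= r.+1)%N -> (e i <= e' i)%N) ->
  (forall i, (r.+1 < i)%N -> (k <= e' i)%N) ->
  ideal_pow I k (\prod_(l < n) 'X_l ^+ e' l).
Proof.
have mul a c j f : (a.+1 < n)%N -> ideal_pow I j f ->
    ideal_pow I (c + j) (edge_mon a ^+ c * f).
  by move=> an If; apply: ideal_powM => //; apply/ideal_powX/mem_edge_mon.
elim: r k e e' => [|r IH] k e e' rn.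
  move=> _ _ ke; rewrite (@edge_mon_factor 0 k) => [|l _ l0 l1].
    rewrite -[X in ideal_pow _ X]addn0; apply: mul => //.
    exact: ideal_pow0.
  by apply: ke; lia.
move=> [j [jk je le Pj]] ee' ke.
rewrite (@edge_mon_factor r.+1 (k - j)) => [|l _ l1 l2]; last first.
  case: (leqP l r) => lr; first by apply: leq_trans (le l lr) (ee' l _); lia.
  by apply: leq_trans (leq_subr _ _) (ke l _); lia.
rewrite -[X in ideal_pow _ X](subnK jk); apply: mul; first exact: rn.
apply: (IH j _ (fun l => e' l - ((l != r.+1) && (l != r.+2)) * (k - j))%N _ Pj)
  => [|i ir|i ir].
- exact: ltnW.
- have := ee' i; case: (leqP i r) => lr; first by have := le i lr; lia.
  by lia.
case: (eqVneq i r.+2) => [->|ni].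
  by rewrite andbF subn0; apply: leq_trans je (ee' _ _).
by have := ke i; lia.
Qed.

Lemma ideal_pow_path r k : n = r.+2 ->
  eq_ideal (mon_ideal (fun m => path_exp r k (exponent m))) (ideal_pow I k).
Proof.
move=> nr f; split.
  move=> Pf; apply: ideal_monomials => [|m /Pf Pm].
    exact: ideal_gen_ideal.
  rewrite mpolyXE_id; pose e i := if (i < n)%N then exponent m i else k.
  rewrite (eq_bigr (fun i : 'I_n => 'X_i ^+ e i)) => [|i _]; last first.
    by rewrite /e ltn_ord exponent_ord.
  apply: path_exp_mem Pm _ _ => [|i ir|i ir]; first by lia.
    by rewrite /e; case: ltnP => //; lia.
  by rewrite /e; case: ltnP => //; lia.
pose J k' := @mon_ideal K n (fun m => path_exp r k' (exponent m)).
move: k f; apply: (@ideal_pow_min _ _ J).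
- move=> k; apply: mon_ideal_ideal => m m'; apply: path_exp_mono => i _.
  by rewrite exponentD leq_addr.
- by move=> m _; apply: path_exp0.
- apply: path_ideal_min => [|a an].
    apply: mon_ideal_ideal => m m'; apply: path_exp_mono => i _.
    by rewrite exponentD leq_addr.
  rewrite edge_monE; apply/mon_idealX; apply: (@path_exp_gen _ a); first by lia.
  move=> i ir ia ia'; have lt_in : (i < n)%N by lia.
  by rewrite -[i]/(nat_of_ord (Ordinal lt_in)) exponent_ord mnmE /= ia ia'.
move=> j k f g; apply: mon_idealM => m m' Pm Pm'.
by apply: path_exp_mono (path_expD Pm Pm') => i _; rewrite exponentD.
Qed.

(** The [N]-th power of the irrelevant ideal. *)
Definition order_ge N : S -> Prop := mon_ideal (fun m => N <= mdeg m)%N.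

Lemma order_ge_ideal N : is_ideal (order_ge N).
Proof.
apply: mon_ideal_ideal => m m' Nm; rewrite mdegD.
exact: leq_trans Nm (leq_addr _ _).
Qed.

Lemma order_geM M N f g :
  order_ge M f -> order_ge N g -> order_ge (M + N) (f * g).
Proof. by apply: mon_idealM => m m' Mm Nm; rewrite mdegD leq_add. Qed.

Lemma path_pow_order k f : ideal_pow I k f -> order_ge (k * (n - 2)) f.
Proof.
move: k f; apply: (@ideal_pow_min _ _ (fun k => order_ge (k * (n - 2)))).
- by move=> k; apply: order_ge_ideal.
- by rewrite mul0n => m.
- apply: path_ideal_min => [|a an]; first exact: order_ge_ideal.
  by rewrite edge_monE; apply/mon_idealX; rewrite mdeg_edge_exp // mul1n.
by move=> j k f g fj gk; rewrite mulnDl; apply: order_geM.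
Qed.

(** * A Koszul cycle of least degree *)

(** The variables indexed by natural numbers, continued by 0, to serve as the
    coordinates of a contraction. *)
Definition xvar (l : nat) : S := if insub l is Some i then 'X_(i : 'I_n) else 0.

Lemma xvarE (i : 'I_n) : xvar i = 'X_i.
Proof. by rewrite /xvar valK. Qed.

Lemma xvar_edge a : (a.+2 < n)%N ->
  xvar a * edge_mon a = xvar a.+2 * edge_mon a.+1.
Proof.
move=> a2n; have a0n : (a < n)%N by lia.
rewrite -[a]/(nat_of_ord (Ordinal a0n)) -[X in xvar X.+2]/a.
rewrite -[a.+2]/(nat_of_ord (Ordinal a2n)) !xvarE /=.
transitivity (\prod_(l < n | l != a.+1 :> nat) ('X_l : S)).
  rewrite [RHS](bigD1 (Ordinal a0n)) /= ?neq_ltn ?ltnSn //; congr (_ * _).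
  by apply: eq_bigl => l; rewrite andbC.
by rewrite (bigD1 (Ordinal a2n)) /= ?neq_ltn ?ltnSn ?orbT.
Qed.

Definition basis_vec (a l : nat) : S := (l == a)%:R.

Lemma bd_wd_basis a (z : ext S n) : (a < n)%N ->
  bd xvar (wd (basis_vec a) z) =
    xvar a *: z - wd (basis_vec a) (bd xvar z).
Proof.
move=> an; rewrite bd_wd (bigD1 (Ordinal an)) //= /basis_vec eqxx mul1r.
rewrite big1 ?addr0 // => l /negbTE; rewrite -val_eqE /= => ->.
by rewrite mul0r.
Qed.

(** The linear relation [x_a u_a = x_(a+2) u_(a+1)] between two consecutive
    generators, as a vector on which contraction by the variables vanishes. *)
Definition rel_vec (a l : nat) : S :=
  edge_mon a * basis_vec a l + (- edge_mon a.+1) * basis_vec a.+2 l.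

Lemma wd_rel_vec a m (z : ext S m) : wd (rel_vec a) z =
  edge_mon a *: wd (basis_vec a) z - edge_mon a.+1 *: wd (basis_vec a.+2) z.
Proof. by rewrite /rel_vec wd_lincomb scaleNr. Qed.

Lemma bd_wd_rel a (z : ext S n) : (a.+2 < n)%N ->
  bd xvar (wd (rel_vec a) z) = - wd (rel_vec a) (bd xvar z).
Proof.
move=> an; rewrite !wd_rel_vec raddfB /= !bdZ !bd_wd_basis //; last by lia.
rewrite !scalerBr !scalerA ![_ * xvar _]mulrC (xvar_edge an).
by rewrite !opprB addrC addrA subrK.
Qed.

Fixpoint rel_prod m a p : ext S m :=
  if p is p'.+1 then wd (rel_vec a) (rel_prod m a.+1 p') else ext1 S m.

Lemma bd_rel_prod a p : (a + p + 2 <= n)%N -> bd xvar (rel_prod n a p) = 0.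
Proof.
elim: p a => [|p IH] a ap /=; first exact: bd_ext1.
by rewrite bd_wd_rel ?IH ?raddf0 ?oppr0 //; lia.
Qed.

Lemma coeffs_in_rel_prod m a p : (a + p + 2 <= n)%N ->
  coeffs_in (ideal_pow I p) (rel_prod m a p).
Proof.
elim: p a => [|p IH] a ap /=.
  by apply: coeffs_in_sub (coeffs_inT _) => f _; apply: ideal_pow0.
apply: coeffs_in_wd (IH a.+1 _); [exact: ideal_gen_ideal | | by lia].
move=> l f If; rewrite -add1n; apply: ideal_powM => //.
have iI : is_ideal I by apply: ideal_gen_ideal.
rewrite -[rel_vec _ _]expr1; apply: ideal_powX; rewrite /rel_vec.
rewrite mulNr; apply: (idealB iI); rewrite mulrC; apply: (idealM iI).
  by apply: mem_edge_mon; lia.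
by apply: mem_edge_mon; lia.
Qed.

Lemma deg_ge_rel_prod m a p : deg_ge p (rel_prod m a p).
Proof.
elim: p a => [|p IH] a /=; first exact: deg_ge0.
exact: deg_ge_wd.
Qed.

(** The coefficient of [e_0 /\ ... /\ e_(p-1)]. *)
Fixpoint init_coeff p m : ext S m -> S :=
  match m return ext S m -> S with
  | 0 => id
  | m'.+1 => fun z => if (m' < p)%N then init_coeff p z.2 else init_coeff p z.1
  end.

Lemma init_coeffZ p m c (z : ext S m) :
  init_coeff p (c *: z) = c * init_coeff p z.
Proof. by elim: m z => //= m IH z; case: ifP. Qed.

Lemma init_coeff_in (J : S -> Prop) p m (z : ext S m) :
  coeffs_in J z -> J (init_coeff p z).
Proof. by elim: m z => //= m IH z [/IH ? /IH ?]; case: ifP. Qed.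

Lemma rel_prod_top a q : rel_prod (a + q).+1 a q.+1 =
  (0, ((-1) ^+ q * edge_mon (a + q)) *: rel_prod (a + q) a q).
Proof.
have step p b (y : ext S p) :
    wd (rel_vec b) ((0, y) : ext S p.+1) = (0, - wd (rel_vec b) y).
  by rewrite /= raddf0 scaler0 sub0r.
elim: q a => [|q IH] a.
  rewrite addn0 expr0 mul1r /= wd_eq0 => [|l la].
    congr (_, _); rewrite raddf0 subr0 /rel_vec /basis_vec eqxx mulr1.
    by rewrite ltn_eqF // mulr0 addr0.
  rewrite /rel_vec /basis_vec !ltn_eqF ?mulr0 ?addr0 //; lia.
have := IH a.+1; rewrite addSnnS => E.
rewrite -[LHS]/(wd (rel_vec a) (rel_prod (a + q.+1).+1 a.+1 q.+1)) E.
by rewrite step wdZ exprS mulN1r mulNr scaleNr.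
Qed.

Lemma rel_prod_fst m a p : (rel_prod m.+1 a p).1 = rel_prod m a p.
Proof. by elim: p a => //= p IH a; rewrite IH. Qed.

(** The matrix of the vectors [rel_vec 0, ..., rel_vec (p - 1)] is triangular
    on the first [p] coordinates. *)
Lemma init_coeff_rel_prod p m : (p <= m)%N ->
  exists b : bool,
    init_coeff p (rel_prod m 0 p) = (-1) ^+ b * \prod_(i < p) edge_mon i.
Proof.
move=> pm.
have -> : init_coeff p (rel_prod m 0 p) = init_coeff p (rel_prod p 0 p).
  rewrite -(subnK pm); elim: (m - p)%N => //= c <-.
  by rewrite ltnNge leq_addl /= rel_prod_fst.
suff H q P : (q <= P)%N -> exists b : bool,
    init_coeff P (rel_prod q 0 q) = (-1) ^+ b * \prod_(i < q) edge_mon i.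
  exact: H.
elim: q => [|q IH] qP.
  by exists false; rewrite big_ord0 mulr1.
have [b bE] := IH (ltnW qP); have := rel_prod_top 0 q; rewrite add0n => ->.
exists (odd q (+) b); rewrite /= qP init_coeffZ bE big_ord_recr /=.
by rewrite signr_addb signr_odd; ring.
Qed.

Lemma irrelevantP f : irrelevant_ideal f ->
  exists v : nat -> S, f = \sum_(l < n) v l * xvar l.
Proof.
move: f; apply: ideal_gen_min => [|f [i ->]].
  split=> [|f g [v ->] [w ->]|a f [v ->]].
  - by exists (fun=> 0); rewrite big1 // => l _; rewrite mul0r.
  - exists (fun l => v l + w l); rewrite -big_split.
    by apply: eq_bigr => l _; rewrite mulrDl.
  exists (fun l => a * v l); rewrite mulr_sumr.
  by apply: eq_bigr => l _; rewrite mulrA.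
exists (basis_vec i); rewrite (bigD1 i) //= /basis_vec eqxx mul1r xvarE.
rewrite big1 ?addr0 // => l /negbTE; rewrite -val_eqE /= => ->.
by rewrite mul0r.
Qed.

Lemma order_irrelevant f : order_ge 1 f -> irrelevant_ideal f.
Proof.
have iI : is_ideal (@irrelevant_ideal K n) by apply: ideal_gen_ideal.
move=> f1; apply: ideal_monomials => // m /f1.
rewrite lt0n mdeg_eq0 => m0.
have [i mi] : exists i, (U_(i) <= m)%MM.
  apply/existsP; apply: contraR m0 => /existsPn m0; apply/eqP/mnmP => i.
  by move: (m0 i); rewrite lep1mP negbK mnm0E => /eqP.
rewrite -(submK mi) mpolyXD; apply: (idealM iI).
by apply: mem_ideal_gen; exists i.
Qed.

(** The wedge product of the linear relations [rel_vec 0, ..., rel_vec (p-1)],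
    times a power of a generator, is a cycle with coefficients in [I^k] of the
    least degree occurring there.  So it is not the boundary of a chain with
    coefficients in [I^k], although it bounds in the Koszul complex of [S]. *)
Lemma regular_path_size k (s : seq S) : (3 <= n)%N -> (0 < k)%N ->
  (forall f, f \in s -> irrelevant_ideal f) ->
  wreg (ideal_pow I k) s -> (size s <= n - 1 - minn k (n - 2))%N.
Proof.
move=> n3 kp sm wr; rewrite leqNgt; apply/negP => ss.
have [q qE] : exists q, minn k (n - 2) = q.+1.
  by exists (minn k (n - 2)).-1; rewrite prednK //; lia.
rewrite qE in ss; have iIk : is_ideal (ideal_pow I k) by apply: ideal_gen_ideal.
pose c := edge_mon 0 ^+ (k - q.+1).
pose w : S := \prod_(l < n | (2 < l)%N) 'X_l.
have n0 : (0 < n)%N by lia.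
have w0 : w * xvar 0 = edge_mon 1.
  rewrite /edge_mon (bigD1 (Ordinal n0)) //= mulrC (xvarE (Ordinal n0)).
  congr (_ * _); apply: eq_bigl => -[l ln]; rewrite -val_eqE /=; lia.
have w2 : w * xvar 2 = edge_mon 0.
  rewrite /edge_mon (bigD1 (Ordinal n3)) //= mulrC (xvarE (Ordinal n3)).
  congr (_ * _); apply: eq_bigl => -[l ln]; rewrite -val_eqE /=; lia.
(* Up to sign, [rel_vec 0] is the boundary of [w e_0 /\ e_2], so that [z] is
   chosen to have the product of the relations as its boundary. *)
pose y := rel_prod n 1 q.
have dy : bd xvar y = 0 by apply: bd_rel_prod; lia.
pose z := c *: (w *: wd (basis_vec 0) (wd (basis_vec 2) y)).
have dz : bd xvar z = - (c *: rel_prod n 0 q.+1).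
  rewrite /z !bdZ !bd_wd_basis // dy raddf0 subr0 wdZ /= wd_rel_vec.
  by rewrite -[RHS]scalerN opprB [w *: _]scalerBr !(scalerA w) w0 w2.
have Idz : coeffs_in (ideal_pow I k) (bd xvar z).
  rewrite dz; apply: coeffs_inN => //.
  apply: coeffs_in_scaled (coeffs_in_rel_prod n (a := 0) (p := q.+1) _)
    => [f If|].
    have kE : k = (k - q.+1 + q.+1)%N by lia.
    rewrite [X in ideal_pow _ X]kE.
    by apply: ideal_powM => //; apply/ideal_powX/mem_edge_mon/ltnW.
  by lia.
have zdeg : deg_ge q.+2 z.
  by do 2! apply: deg_geZ; do 2! apply: deg_ge_wd; apply: deg_ge_rel_prod.
have [u Iu] : exists u, coeffs_in (ideal_pow I k) (z - bd xvar u).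
  apply: koszul_vanishing wr _ zdeg Idz => //; last first.
    by move: ss qE; move: (size s) => r; lia.
  by move=> f /sm/irrelevantP.
(* Each coefficient of the boundary of [z - bd u] is in [(x) I^k]. *)
have : coeffs_in (order_ge (k * (n - 2)).+1) (bd xvar z).
  have -> : bd xvar z = bd xvar (z - bd xvar u).
    by rewrite raddfB /= bd_bd subr0.
  apply: coeffs_in_bd Iu => [|l f /path_pow_order Of].
    exact: order_ge_ideal.
  rewrite -add1n; apply: order_geM => //; rewrite /xvar.
  case: insubP => [i _ _|_]; last exact: ideal0 (order_ge_ideal _).
  by apply/mon_idealX; rewrite mdeg1.
have iO := order_ge_ideal (k * (n - 2)).+1.
have qn : (q.+1 <= n)%N by lia.
have [b bE] := init_coeff_rel_prod qn.
move/(init_coeff_in q.+1); rewrite dz -scaleN1r scalerA init_coeffZ bE.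
pose M := (edge_exp 0 *+ (k - q.+1) + \sum_(i < q.+1) edge_exp i)%MM.
have -> : -1 * c * ((-1) ^+ b * \prod_(i < q.+1) edge_mon i) =
    - (-1) ^+ b * 'X_[M].
  rewrite mpolyXD -mpolyXn -edge_monE -mprodXE.
  under [in RHS]eq_bigr => i _ do rewrite -edge_monE.
  by rewrite -/c; ring.
move/(idealM iO (- (-1) ^+ b)); rewrite mulrA mulrNN -expr2 sqrr_sign mul1r.
move/mon_idealX; rewrite mdegD mdegMn mdeg_edge_exp ?(ltnW n3) //.
rewrite mdeg_sum (eq_bigr (fun=> (n - 2)%N)) => [|i _]; last first.
  by apply: mdeg_edge_exp; have := ltn_ord i; lia.
rewrite sum_nat_const card_ord [((n - 2) * _)%N]mulnC -mulnDl.
by rewrite subnK ?ltnn //; lia.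
Qed.

End PathIdeal.

(** * The depth of the powers *)

Theorem path_depth (K : fieldType) (n k : nat) : (3 <= n)%N -> (1 <= k)%N ->
  depth_quot_is (ideal_pow (compl_edge_ideal K (path_graph n)) k)
    (n - 1 - minn k (n - 2)).
Proof.
move=> n3 kp; set I := compl_edge_ideal K _; set d := (n - 1 - _)%N.
have iIk : is_ideal (ideal_pow I k) by apply: ideal_gen_ideal.
split; last first.
  by move=> s sm [/(wregP _ iIk) wr _]; apply: regular_path_size.
have ord1 f : f \in esyms K n d -> order_ge 1 f.
  move=> /mem_esyms[e ep ->] m; rewrite msupp_mesymP => /existsP[h].
  by case/andP => /eqP he /eqP ->; rewrite mdeg_mesym1 he.
exists (esyms K n d); split; first exact: size_esyms.
  by move=> f /ord1/order_irrelevant.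
split.
  apply/(wregP _ iIk).
  have nE : n = (n - 2).+2 by lia.
  apply: (eq_wreg (ideal_pow_path k nE)).
  have upP : wreg (@mon_ideal K n (fun m =>
      has_var set0 m \/ path_exp (n - 2) k (exponent m))) (esyms K n d).
    apply: wreg_path => [|i|]; first by lia.
      by rewrite inE.
    by rewrite cards0 /d; lia.
  apply: eq_wreg_mon upP => m; split; last by right.
  by case=> // -[i]; rewrite inE.
have iO := @order_ge_ideal K n 1.
have : ~ order_ge 1 (1 : {mpoly K[n]}).
  by rewrite -mpolyX0 => /mon_idealX; rewrite mdeg0.
apply: contra_not; apply: ideal_gen_min => // f [/path_pow_order|/ord1 //].
by apply: mon_ideal_sub => m; apply: leq_trans; rewrite muln_gt0 kp; lia.
Qed.

Lemma depth_quot_unique (K : fieldType) n (J : {mpoly K[n]} -> Prop) d d' :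
  depth_quot_is J d -> depth_quot_is J d' -> d = d'.
Proof.
move=> [[s [sd sm sr]] dmax] [[t [td tm tr]] dmax'].
by apply/eqP; rewrite eqn_leq -{1}sd -{2}td dmax' // dmax.
Qed.

Theorem proposition4p6 (K : fieldType) (n : nat) (hn : (3 <= n)%N) :
  [/\ forall k : nat, (1 <= k <= n - 3)%N ->
        depth_quot_is
          (ideal_pow (compl_edge_ideal K (path_graph n)) k) (n - k - 1)%N,
      forall k : nat, (n - 2 <= k)%N ->
        depth_quot_is (ideal_pow (compl_edge_ideal K (path_graph n)) k) 1%N
    & dstab_is (compl_edge_ideal K (path_graph n)) (n - 2)%N].
Proof.
have small k : (1 <= k <= n - 3)%N -> depth_quot_is
    (ideal_pow (compl_edge_ideal K (path_graph n)) k) (n - k - 1).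
  move=> /andP[k1 kn]; have := path_depth K hn k1.
  by rewrite (_ : n - 1 - minn k (n - 2) = n - k - 1)%N //; lia.
have large k : (n - 2 <= k)%N -> depth_quot_is
    (ideal_pow (compl_edge_ideal K (path_graph n)) k) 1.
  move=> kn; have k1 : (1 <= k)%N by lia.
  have := path_depth K hn k1.
  by rewrite (_ : n - 1 - minn k (n - 2) = 1)%N //; lia.
split=> //; split; [by lia | by exists 1%N |].
move=> k k1 [d kd]; rewrite leqNgt; apply/negP => kn.
have d1 := depth_quot_unique (kd _ (ltnW kn)) (large _ (leqnn _)).
have kle : (1 <= k <= n - 3)%N by lia.
have dk := depth_quot_unique (kd k (leqnn k)) (small k kle).
by lia.
Qed.
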